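(* There is a $21\,CS\to4\,CS$ distillation protocol at distance $3$: choose representatives $(X,Y,Z)$ of the 21 points of the projective plane over $\mathbb F_4$, namely $$\{(1,y,z):y,z\in\mathbb F_4\}\cup\{(0,1,z):z\in\mathbb F_4\}\cup\{(0,0,1)\},$$ and let $G\in\mathbb F_4^{7\times21}$ have rows the evaluations at these points of $$X(Z^3+\omega Y^3),\quad Y(X^3+\omega Z^3),\quad Z(Y^3+\omega X^3),\quad XYZ^2\ \text{(logical rows)},\qquad X,\quad Y,\quad Z\ \text{(stabilizer rows)}.$$ Then $G$ has full rank and satisfies $$\sum_ig_{a,i}g_{b,i}g_{c,i}=\begin{cases}1&1\le a=b=c\le4\\0&\text{otherwise}\end{cases}\qquad(1\le a,b,c\le7);$$ consequently $D_G=C\,(CS^{\otimes4}\otimes I)$ for some diagonal Clifford unitary $C$ ($CS^{\otimes4}$ acting on the first four qudits); and the $Z$-distance of the code is $3$.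
   Context: $\mathbb F_4=\{0,1,\omega,\omega^2\}$, $\omega^2=\omega+1$. Writing $\gamma=b_1\omega+b_2\omega^2$ ($b_1,b_2\in\{0,1\}$) identifies an $\mathbb F_4$-qudit with two qubits, and $CS|\gamma\rangle=i^{b_1b_2}|\gamma\rangle$; put $c(\gamma)=b_1b_2$. A full-rank matrix $G\in\mathbb F_4^{m\times n}$ with $k$ logical rows defines a CSS code on $n$ $\mathbb F_4$-qudits: the first $k$ rows are $X$-logical operators, the last $m-k$ rows are $X$-stabilizer generators. Its $Z$-distance is the minimum Hamming weight over $\mathbb F_4$ of a vector in $\mathbb F_4^n$ orthogonal (for $\sum x_iy_i$) to all stabilizer rows but not to at least one logical row. The unitary on $m$ qudits ($2m$ qubits) induced by applying $CS$ to each of the $n$ physical qudits is $D_G|u\rangle=i^{\sum_{i=1}^nc(\sum_au_ag_{a,i})}|u\rangle$, $u\in\mathbb F_4^m$ (inner sum in $\mathbb F_4$, outer sum over integers). *)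

(* Defs.v *)
From mathcomp Require Import all_boot all_order all_algebra.
From mathcomp Require Import reals complex.

Set Implicit Arguments.
Unset Strict Implicit.
Unset Printing Implicit Defensive.

Import Order.TTheory GRing.Theory Num.Theory.
Local Open Scope ring_scope.
Local Open Scope sesquilinear_scope.

(* An operator on the Hilbert space with orthonormal basis |t>, t : T (T a
   finite type), is a matrix in 'M[C]_#|T|.  Its rows and columns are numbered
   by enum_rank, so <s|A|t> is A (enum_rank s) (enum_rank t). *)
Section Operators.
Variable C : numClosedFieldType.

Definition op (T : finType) (f : T -> T -> C) : 'M[C]_#|T| :=
  \matrix_(i, j) f (enum_val i) (enum_val j).

Definition entry (T : finType) (A : 'M[C]_#|T|) (s t : T) : C :=
  A (enum_rank s) (enum_rank t).

(* |t> |-> f t |t> *)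
Definition diag_op (T : finType) (f : T -> C) : 'M[C]_#|T| :=
  diag_mx (\row_i f (enum_val i)).

(* A 0 (x) ... (x) A (m-1), acting on m qudits; the computational basis of the
   m-qudit space is indexed by the row vectors u : 'rV[F]_m. *)
Definition tensor_op (F : finFieldType) (m : nat) (A : 'I_m -> 'M[C]_#|F|) :
    'M[C]_#|{: 'rV[F]_m}| :=
  op (fun u v : 'rV[F]_m => \prod_a entry (A a) (u 0 a) (v 0 a)).

End Operators.

Section Qudits.
Variables (C : numClosedFieldType) (F : finFieldType) (w : F).

(* The pair (b1, b2) with g = b1 w + b2 w^2; it exists and is unique when F has
   four elements and w^2 = w + 1. *)
Definition bits (g : F) : bool * bool :=
  odflt (false, false)
    [pick b : bool * bool | g == b.1%:R * w + b.2%:R * w ^+ 2].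

Definition cfun (g : F) : nat := ((bits g).1 * (bits g).2)%N.

Definition CS : 'M[C]_#|F| := diag_op (fun g : F => 'i ^+ cfun g).

Definition D_ (m n : nat) (G : 'M[F]_(m, n)) : 'M[C]_#|{: 'rV[F]_m}| :=
  diag_op (fun u : 'rV[F]_m =>
    'i ^+ (\sum_(i < n) cfun (\sum_(a < m) u 0 a * G a i)%R)%N).

(* X^x Z^z on one qubit *)
Definition pauli1 (x z : bool) : 'M[C]_#|{: bool}| :=
  (if x then op (fun r s : bool => (r != s)%:R) else 1%:M) *m
  (if z then diag_op (fun s : bool => (-1) ^+ s) else 1%:M).

(* A (x) B on the two qubits that make up a qudit, |g> = |b1>|b2> *)
Definition two_qubit_op (A B : 'M[C]_#|{: bool}|) : 'M[C]_#|F| :=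
  op (fun g h : F => entry A (bits g).1 (bits h).1 *
                     entry B (bits g).2 (bits h).2).

(* The Pauli group on the 2m qubits of m qudits, with phases 1, i, -1, -i
   (so that Y = i X Z is included). *)
Definition is_pauli (m : nat) (P : 'M[C]_#|{: 'rV[F]_m}|) : Prop :=
  exists (k : nat) (x1 z1 x2 z2 : 'I_m -> bool),
    P = 'i ^+ k *: tensor_op (fun a =>
          two_qubit_op (pauli1 (x1 a) (z1 a)) (pauli1 (x2 a) (z2 a))).

Definition is_clifford (m : nat) (U : 'M[C]_#|{: 'rV[F]_m}|) : Prop :=
  U \is unitarymx /\
  forall P : 'M[C]_#|{: 'rV[F]_m}|, is_pauli P -> is_pauli (U *m P *m U ^t*).

End Qudits.

Section Code.
Variables (F : finFieldType) (m n : nat).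

Definition weight (x : 'rV[F]_n) : nat := #|[set i | x 0 i != 0]|.

(* Rows a < k of G are logical, rows k <= a < m are stabilizer generators. *)
Definition Z_logical (G : 'M[F]_(m, n)) (k : nat) (x : 'rV[F]_n) : Prop :=
  (forall a : 'I_m, (k <= a)%N -> \sum_i x 0 i * G a i = 0) /\
  (exists a : 'I_m, (a < k)%N /\ \sum_i x 0 i * G a i <> 0).

Definition has_Z_distance (G : 'M[F]_(m, n)) (k d : nat) : Prop :=
  (exists x, Z_logical G k x /\ weight x = d) /\
  (forall x, Z_logical G k x -> (d <= weight x)%N).

End Code.

Section Plane.
Variables (F : finFieldType) (w : F).

Definition plane_points : seq (F * F * F) :=
  [seq (1, y, z) | y <- enum F, z <- enum F] ++
  [seq (0, 1, z) | z <- enum F] ++ [:: (0, 0, 1)].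

Definition row_evals (p : F * F * F) : seq F :=
  let: (X, Y, Z) := p in
  [:: X * (Z ^+ 3 + w * Y ^+ 3);
      Y * (X ^+ 3 + w * Z ^+ 3);
      Z * (Y ^+ 3 + w * X ^+ 3);
      X * Y * Z ^+ 2;
      X; Y; Z].

(* plane_points has exactly 21 elements when #|F| = 4. *)
Definition plane_matrix : 'M[F]_(7, 21) :=
  \matrix_(a < 7, i < 21)
    nth 0 (row_evals (nth (0, 0, 0) plane_points i)) a.

End Plane.

(* Main.v *)
Require Import Defs.
From mathcomp Require Import all_boot all_order all_fingroup all_algebra.
From mathcomp Require Import reals complex.
From mathcomp Require Import ring.

(* The third polarization of the exponent c of CS is (x, y, z) |-> 2 Tr(x y z)
   modulo 4.  Hence the third polarization of the exponent of D_G is governed by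
   the trilinear sums of the rows of G; when these equal those of CS on the
   logical qudits, the difference of the two exponents is a Z/4-valued quadratic
   form over F_2, and the corresponding diagonal unitary is Clifford.  The
   trilinear sums are evaluated in coordinates over the basis (w, w^2).  The
   stabilizer rows X, Y, Z list the points themselves, so a Z-logical vector is a
   linear dependency among points of the plane; two points are independent. *)

Set Implicit Arguments.
Unset Strict Implicit.
Unset Printing Implicit Defensive.

Import Order.TTheory GRing.Theory Num.Theory.
Local Open Scope ring_scope.

(** * Matrix entries of operators and unitarity of diagonal phases *)

Section OperatorEntries.
Local Open Scope sesquilinear_scope.
Variables (C : numClosedFieldType) (T : finType).
Implicit Types (A B : 'M[C]_#|T|) (f g : T -> C).

Lemma entry_op (F : T -> T -> C) s t : entry (op F) s t = F s t.
Proof. by rewrite /entry mxE !enum_rankK. Qed.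

Lemma eq_entry A B : (forall s t, entry A s t = entry B s t) -> A = B.
Proof.
move=> eqAB; apply/matrixP => i j.
by have := eqAB (enum_val i) (enum_val j); rewrite /entry !enum_valK.
Qed.

Lemma entry1 s t : entry (1%:M : 'M[C]_#|T|) s t = (s == t)%:R.
Proof. by rewrite /entry mxE (inj_eq enum_rank_inj). Qed.

Lemma entryZ c A s t : entry (c *: A) s t = c * entry A s t.
Proof. by rewrite /entry mxE. Qed.

Lemma entry_diag_op f s t : entry (diag_op f) s t = f s *+ (s == t).
Proof. by rewrite /entry !mxE (inj_eq enum_rank_inj) enum_rankK. Qed.

Lemma entry_diag_mul f A s t : entry (diag_op f *m A) s t = f s * entry A s t.
Proof. by rewrite /entry mul_diag_mx !mxE enum_rankK. Qed.

Lemma entry_mul_diag f A s t : entry (A *m diag_op f) s t = entry A s t * f t.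
Proof. by rewrite /entry mul_mx_diag !mxE enum_rankK. Qed.

Lemma diag_op_adjoint f : (diag_op f) ^t* = diag_op (fun t => (f t)^*).
Proof.
apply: eq_entry => s t; rewrite entry_diag_op /entry !mxE.
rewrite (inj_eq enum_rank_inj) enum_rankK eq_sym.
by case: eqP => [->|_]; rewrite ?mulr1n ?mulr0n ?rmorph0.
Qed.

Lemma diag_op_is_diag f : is_diag_mx (diag_op f).
Proof. exact: diag_mx_is_diag. Qed.

Lemma diag_op_unitary f : (forall t, f t * (f t)^* = 1) ->
  diag_op f \is unitarymx.
Proof.
move=> f1; apply/unitarymxP; rewrite diag_op_adjoint; apply: eq_entry => s t.
rewrite entry_diag_mul entry_diag_op entry1.
by case: eqP => _; rewrite ?mulr1n ?f1 // mulr0n mulr0.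
Qed.

End OperatorEntries.

Lemma tensor_diag_op (C : numClosedFieldType) (F : finFieldType) m
    (A : 'I_m -> 'M[C]_#|F|) (f : 'I_m -> F -> C) :
  (forall a, A a = diag_op (f a)) ->
  tensor_op A = diag_op (fun u : 'rV[F]_m => \prod_a f a (u 0 a)).
Proof.
move=> Af; apply: eq_entry => u v; rewrite entry_op entry_diag_op.
under eq_bigr do rewrite Af entry_diag_op.
have [->|neq] := eqVneq u; first by apply: eq_bigr => a _; rewrite eqxx.
have [a neq_a] : exists a, u 0 a != v 0 a.
  apply/existsP; apply: contra_neqT neq => /existsPn eq_uv.
  by apply/rowP => a; apply/eqP/negPn.
by rewrite (bigD1 a) //= (negPf neq_a) mul0r.
Qed.

(** * Phases i^z as a character of Z/4 *)

Section IPow.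
Variable C : numClosedFieldType.

(** The exponent is the representative of [z] in {0, 1, 2, 3}; since i^4 = 1, sums in Z/4 become
    products of phases. *)
Definition ipow (z : 'Z_4) : C := 'i ^+ z.

Lemma expi4 : 'i ^+ 4 = 1 :> C.
Proof. by rewrite -[4%N]/(2 * 2)%N exprM sqrCi sqrrN expr1n. Qed.

Lemma ipow_nat n : ipow n%:R = 'i ^+ n.
Proof. by rewrite /ipow Zp_nat /= expr_mod // expi4. Qed.

Lemma ipowD y z : ipow (y + z) = ipow y * ipow z.
Proof. by rewrite /ipow /= expr_mod ?expi4 // exprD. Qed.

Lemma ipow_sum (I : finType) (y : I -> 'Z_4) :
  ipow (\sum_i y i) = \prod_i ipow (y i).
Proof. by rewrite (big_morph ipow ipowD (erefl _)). Qed.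

Lemma ipow_conj z : ipow z * (ipow z)^* = 1.
Proof. by rewrite /ipow rmorphXn /= -exprMn conjCi mulrN -expr2 sqrCi opprK expr1n. Qed.

Lemma ipow_even z : z *+ 2 = 0 -> ipow z = (-1) ^+ (z == 2%:R).
Proof.
move=> z2; rewrite -sqrCi -exprM /ipow; congr (_ ^+ _).
by case: z z2 => [[|[|[|[|]]]] ?] // /eqP; rewrite -val_eqE.
Qed.

End IPow.
Arguments ipow {C}.

(** * Third differences of Z/4-valued functions *)

Section ThirdPolarization.
Variable V : zmodType.
Implicit Types (q : V -> 'Z_4) (x y z : V).

(** The third difference with its term [- q 0] left out, so that identical vanishing forces
    [q 0 = 0] besides degree at most two. *)
Definition polar3 q x y z : 'Z_4 :=
  q (x + y + z) - q (x + y) - q (y + z) - q (x + z) + q x + q y + q z.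

Definition polar q x y : 'Z_4 := q (x + y) - q x - q y.

(** The additivity defect of [polar q] in its first argument is exactly [polar3 q]. *)
Lemma polarDl q z : (forall x y z, polar3 q x y z = 0) ->
  {morph polar q ^~ z : x y / x + y}.
Proof.
move=> q3 x y; apply/eqP; rewrite -subr_eq0 -(q3 x y z) /polar /polar3.
by apply/eqP; ring.
Qed.

Lemma polar0l q z : (forall x y z, polar3 q x y z = 0) -> polar q 0 z = 0.
Proof.
by move=> q3; apply: (addIr (polar q 0 z)); rewrite -polarDl // !add0r.
Qed.

Lemma polar3_sum (I : finType) (P : pred I) (q : I -> V -> 'Z_4) x y z :
  polar3 (fun u => \sum_(i | P i) q i u) x y z =
  \sum_(i | P i) polar3 (q i) x y z.
Proof. by rewrite /polar3 !big_split /= !sumrN. Qed.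

End ThirdPolarization.

(** * Arithmetic of F_4 in the basis (w, w^2) *)

Section FieldOfFour.
Variables (F : finFieldType) (w : F).
Hypotheses (card_F : #|F| = 4%N) (w_eq : w ^+ 2 = w + 1).

(** Lagrange in the additive group of order 4 gives 4 = 0; as 4 = 2^2, a field then has 2 = 0. *)
Lemma addff (x : F) : x + x = 0.
Proof.
have F4 : (4%:R : F) = 0.
  have := cyclic.expg_cardG (in_setT (1 : F)).
  by rewrite cardsT card_F FinRing.zmodXgE.
suff F2 : (2%:R : F) = 0 by rewrite -mulr2n -mulr_natl F2 mul0r.
by apply/eqP; rewrite -sqrf_eq0 -natrX F4.
Qed.

Definition unbits (b : bool * bool) : F := b.1%:R * w + b.2%:R * w ^+ 2.

Lemma unbitsE b : unbits b =
  if b.1 then if b.2 then 1 else w else if b.2 then w + 1 else 0.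
Proof.
case: b => [[] []]; rewrite /unbits /= w_eq ?mul1r ?mul0r ?addr0 ?add0r //.
by rewrite addrA addff add0r.
Qed.

Definition addb2 (a b : bool * bool) := (a.1 (+) b.1, a.2 (+) b.2).

Lemma unbitsD a b : unbits (addb2 a b) = unbits a + unbits b.
Proof.
have natr_addb (c d : bool) : (c (+) d)%:R = c%:R + d%:R :> F.
  by case: c d => [] [] /=; rewrite ?addff ?addr0 ?add0r.
by rewrite /unbits /= !natr_addb; ring.
Qed.

(** By additivity a trivial kernel suffices, and 1, w and w + 1 = w^2 are nonzero. *)
Lemma unbits_inj : injective unbits.
Proof.
have w0 : w != 0.
  by apply: contra_eq_neq w_eq => ->; rewrite expr0n add0r eq_sym oner_eq0.
have wD1 : w + 1 != 0 by rewrite -w_eq expf_eq0.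
have unbits_eq0 b : unbits b = 0 -> b = (false, false).
  by case: b => [[] []]; rewrite unbitsE //= => /eqP;
    rewrite ?oner_eq0 ?(negPf w0) ?(negPf wD1).
move=> a b eq_ab; have := unbits_eq0 (addb2 a b).
rewrite unbitsD eq_ab addff => /(_ erefl).
by case: a b {eq_ab} => [[] []] [[] []].
Qed.

(** An injection between sets of four elements is onto, so the [pick] in [bits] succeeds and its
    default is never reached. *)
Lemma bitsK : cancel (bits w) unbits.
Proof.
move=> g; rewrite /bits; case: pickP => [b /eqP ->//|nob].
have [|h _ hK] := inj_card_bij unbits_inj; first by rewrite card_F card_prod card_bool.
by have := nob (h g); rewrite -/(unbits (h g)) hK eqxx.
Qed.

Lemma unbitsK : cancel unbits (bits w).
Proof. by move=> b; apply: unbits_inj; rewrite bitsK. Qed.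

(* From w * w^2 = 1 = w + w^2 and w^2 * w^2 = w. *)
Definition mulb2 (a b : bool * bool) :=
  let c := (a.1 && b.2) (+) (a.2 && b.1) in
  ((a.2 && b.2) (+) c, (a.1 && b.1) (+) c).

Lemma unbitsM a b : unbits (mulb2 a b) = unbits a * unbits b.
Proof.
have wwE : w * w = w + 1 by rewrite -expr2.
have n11 := addff 1; have ww := addff w.
have wD1w : (w + 1) * w = 1 by rewrite mulrDl wwE mul1r addrAC ww add0r.
have wD1wD1 : (w + 1) * (w + 1) = w.
  by rewrite mulrDr wD1w mulr1 addrCA n11 addr0.
case: a b => [[] []] [[] []]; rewrite !unbitsE /= ?mulr0 ?mul0r ?mulr1 ?mul1r //.
by rewrite mulrC.
Qed.

Lemma bitsD g h : bits w (g + h) = addb2 (bits w g) (bits w h).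
Proof. by apply: unbits_inj; rewrite unbitsD !bitsK. Qed.

Lemma bitsM g h : bits w (g * h) = mulb2 (bits w g) (bits w h).
Proof. by apply: unbits_inj; rewrite unbitsM !bitsK. Qed.

(* Twice the absolute trace, which on a w + b w^2 is a + b. *)
Definition trace2 (g : F) : 'Z_4 :=
  if (bits w g).1 (+) (bits w g).2 then 2%:R else 0.

Lemma trace2D : {morph trace2 : g h / g + h}.
Proof.
move=> g h; rewrite /trace2 bitsD.
by case: (bits w g) (bits w h) => [[] []] [[] []]; apply/val_inj.
Qed.

Lemma trace2_0 : trace2 0 = 0.
Proof. by apply: (addIr (trace2 0)); rewrite -trace2D !add0r. Qed.

(** Both sides depend only on the three bit pairs, which leaves 64 evaluations in Z/4. *)
Lemma polar3_cfun x y z :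
  polar3 (fun g => (cfun w g)%:R) x y z = trace2 (x * y * z).
Proof.
rewrite /polar3 /cfun /trace2 !bitsM !bitsD.
by case: (bits w x) (bits w y) (bits w z) => [[] []] [[] []] [[] []];
  apply/val_inj.
Qed.

End FieldOfFour.

(** * Pauli operators as signed translations, and Clifford phases *)

Section PauliAndClifford.
Variables (C : numClosedFieldType) (F : finFieldType) (w : F).
Hypotheses (card_F : #|F| = 4%N) (w_eq : w ^+ 2 = w + 1).
Variable m : nat.
Implicit Types (u v t : 'rV[F]_m) (z : 'I_m -> bool * bool).

Lemma entry_pauli1 (x z r s : bool) :
  entry (pauli1 C x z) r s = (r == s (+) x)%:R * (-1) ^+ (z && s).
Proof.
have entryX : entry (if x then op (fun r s : bool => (r != s)%:R) else 1%:M) r s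
    = (r == s (+) x)%:R :> C.
  by case: x; rewrite ?entry_op ?entry1; case: r s => [] [].
rewrite /pauli1; case: z => /=; first by rewrite entry_mul_diag entryX.
by rewrite mulmx1 entryX mulr1.
Qed.

(** Addition in F_4 is bitwise XOR in the basis (w, w^2), so the two bit flips form one
    translation. *)
Lemma entry_qudit_pauli (x z : bool * bool) (g h : F) :
  entry (two_qubit_op w (pauli1 C x.1 z.1) (pauli1 C x.2 z.2)) g h =
  (g == h + unbits w x)%:R *
  ((-1) ^+ (z.1 && (bits w h).1) * (-1) ^+ (z.2 && (bits w h).2)).
Proof.
rewrite entry_op !entry_pauli1 mulrACA -natrM mulnb; congr (_%:R * _).
by rewrite -(inj_eq (can_inj (bitsK card_F w_eq))) bitsD // unbitsK.
Qed.

(** The additive character of F^m by which the Z-part of a Pauli acts on basis states. *)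
Definition pauli_sign z v : C :=
  \prod_a ((-1) ^+ ((z a).1 && (bits w (v 0 a)).1) *
           (-1) ^+ ((z a).2 && (bits w (v 0 a)).2)).

Lemma pauli_signM z1 z2 v :
  pauli_sign z1 v * pauli_sign z2 v =
  pauli_sign (fun a => addb2 (z1 a) (z2 a)) v.
Proof.
rewrite /pauli_sign -big_split; apply: eq_bigr => a _ /=.
by rewrite mulrACA -!signr_addb !andb_addl.
Qed.

Lemma entry_tensor_pauli (x z : 'I_m -> bool * bool) u v :
  entry (tensor_op (fun a =>
    two_qubit_op w (pauli1 C (x a).1 (z a).1) (pauli1 C (x a).2 (z a).2))) u v =
  (u == v + \row_a unbits w (x a))%:R * pauli_sign z v.
Proof.
rewrite entry_op; under eq_bigr do rewrite entry_qudit_pauli.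
rewrite big_split /=; congr (_ * _).
have [->|neq] := eqVneq.
  by apply: big1 => a _; rewrite !mxE eqxx.
have [a neq_a] : exists a, u 0 a != v 0 a + unbits w (x a).
  apply/existsP; apply: contra_neqT neq => /existsPn eq_uv.
  by apply/rowP => a; rewrite !mxE; have /negPn/eqP := eq_uv a.
by rewrite (bigD1 a) //= (negPf neq_a) mul0r.
Qed.

(** Normal form of a Pauli: a power of i, a translation by [t] and a sign character. *)
Lemma pauliP (P : 'M[C]_#|{: 'rV[F]_m}|) :
  is_pauli w P <-> exists k t z, forall u v,
    entry P u v = (u == v + t)%:R * ('i ^+ k * pauli_sign z v).
Proof.
split=> [[k [x1 [z1 [x2 [z2 ->]]]]] | [k [t [z eP]]]].
  exists k, (\row_a unbits w (x1 a, x2 a)), (fun a => (z1 a, z2 a)) => u v.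
  rewrite entryZ mulrCA; congr (_ * _).
  exact: (entry_tensor_pauli (fun a => (x1 a, x2 a)) (fun a => (z1 a, z2 a))).
exists k, (fun a => (bits w (t 0 a)).1), (fun a => (z a).1),
  (fun a => (bits w (t 0 a)).2), (fun a => (z a).2).
apply: eq_entry => u v; rewrite eP entryZ.
rewrite (entry_tensor_pauli (fun a => bits w (t 0 a)) z) [RHS]mulrCA.
congr ((_ == _ + _)%:R * _).
by apply/rowP => a; rewrite mxE bitsK.
Qed.

Variable q : 'rV[F]_m -> 'Z_4.
Hypothesis q_quadratic : forall u v t, polar3 q u v t = 0.

(** In characteristic 2 the additive map [polar q ^~ t] takes values in {0, 2}. It is fixed by its
    values on the F_2-basis w e_a, w^2 e_a, and [z] records which of them are 2. *)
Lemma ipow_polar t : exists z, forall v, ipow (polar q v t) = pauli_sign z v.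
Proof.
pose e a : 'rV[F]_m := delta_mx 0 a.
pose z a := (polar q (w *: e a) t == 2%:R, polar q (w ^+ 2 *: e a) t == 2%:R).
exists z => v.
have even x : polar q x t *+ 2 = 0.
  rewrite mulr2n -polarDl // (_ : x + x = 0) ?polar0l //.
  by apply/rowP => a; rewrite !mxE (addff card_F).
have polar_bit (b : bool) x :
    ipow (polar q (b%:R *: x) t) = (-1) ^+ ((polar q x t == 2%:R) && b) :> C.
  case: b; first by rewrite scale1r andbT ipow_even.
  by rewrite scale0r polar0l // andbF /ipow expr0.
rewrite {1}(row_sum_delta v).
rewrite (big_morph (polar q ^~ t) (polarDl t q_quadratic) (polar0l t q_quadratic)).
rewrite ipow_sum /pauli_sign; apply: eq_bigr => a _ /=.
rewrite -{1}[v 0 a](bitsK card_F w_eq) /unbits scalerDl -!scalerA.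
by rewrite polarDl // ipowD !polar_bit.
Qed.

(* Conjugation by the diagonal operator multiplies the Pauli entry at
   (v + t, v) by i^(q (v + t) - q v) = i^(q t + polar q v t), and the polar form
   is F_2-linear in v with values in {0, 2}. *)
Lemma quadratic_phase_clifford : is_clifford w (diag_op (fun u => ipow (q u) : C)).
Proof.
split=> [|P /pauliP [k [t [z eP]]]].
  by apply: diag_op_unitary => u; apply: ipow_conj.
have [z' ez'] := ipow_polar t; apply/pauliP.
exists (k + q t)%N, t, (fun a => addb2 (z a) (z' a)) => u v.
rewrite diag_op_adjoint entry_mul_diag entry_diag_mul eP -pauli_signM.
have [->|_] := eqVneq u; last by rewrite !mul0r mulr0 mul0r.
have -> : q (v + t) = polar q v t + q v + q t by rewrite /polar; ring.
move: (polar q v t) (ez' v) => p ep.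
rewrite !ipowD ep exprD -/(ipow (q t)).
(* The factor i^(q v) on the left side meets its conjugate; their product 1 is inserted on the right
   so that [ring] can match both sides. *)
rewrite -[RHS]mul1r -[X in _ = X * _](ipow_conj C (q v)).
ring.
Qed.

End PauliAndClifford.

(** * From trilinear sums of rows to the factorization of [D_] *)

Section Triorthogonal.
Variables (C : numClosedFieldType) (F : finFieldType) (w : F).
Hypotheses (card_F : #|F| = 4%N) (w_eq : w ^+ 2 = w + 1).
Variables (m n k : nat) (G : 'M[F]_(m, n)).
Hypothesis triorthogonal : forall a b c : 'I_m,
  \sum_i G a i * G b i * G c i = if [&& a == b, b == c & (a < k)%N] then 1 else 0.

(** Expand trilinearly in the rows; only the terms a = b = c < k survive. *)
Lemma triorthogonal_sum (u v t : 'rV[F]_m) :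
  \sum_i (u *m G) 0 i * (v *m G) 0 i * (t *m G) 0 i =
  \sum_(a < m | (a < k)%N) u 0 a * v 0 a * t 0 a.
Proof.
transitivity (\sum_a \sum_b \sum_c u 0 a * v 0 b * t 0 c *
                (\sum_i G a i * G b i * G c i)).
  under eq_bigr => i _ do rewrite !mxE big_distrlr /= mulr_suml.
  rewrite exchange_big /=; apply: eq_bigr => a _.
  under eq_bigr do rewrite mulr_suml.
  rewrite exchange_big /=; apply: eq_bigr => b _.
  under eq_bigr do rewrite mulr_sumr.
  rewrite exchange_big /=; apply: eq_bigr => c _.
  by rewrite mulr_sumr; apply: eq_bigr => i _; ring.
rewrite [RHS]big_mkcond; apply: eq_bigr => a _.
rewrite (bigD1 a) //= [X in _ + X]big1 ?addr0 => [|b ba]; last first.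
  by apply: big1 => c _; rewrite triorthogonal eq_sym (negPf ba) mulr0.
rewrite (bigD1 a) //= [X in _ + X]big1 ?addr0 => [|c ca]; last first.
  by rewrite triorthogonal (eq_sym a c) (negPf ca) andbF mulr0.
by rewrite triorthogonal !eqxx /=; case: ifP; rewrite ?mulr1 ?mulr0.
Qed.

Definition phase_defect (u : 'rV[F]_m) : 'Z_4 :=
  \sum_i (cfun w ((u *m G) 0 i))%:R
  - \sum_(a < m | (a < k)%N) (cfun w (u 0 a))%:R.

(** By [polar3_cfun] and additivity of the trace, each of the two sums has [trace2] of a trilinear
    sum as third polarization; [triorthogonal_sum] equates them. *)
Lemma phase_defect_quadratic u v t : polar3 phase_defect u v t = 0.
Proof.
pose f (u : 'rV[F]_m) : 'Z_4 := \sum_i (cfun w ((u *m G) 0 i))%:R.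
pose g (u : 'rV[F]_m) : 'Z_4 := \sum_(a < m | (a < k)%N) (cfun w (u 0 a))%:R.
have -> : polar3 phase_defect u v t = polar3 f u v t - polar3 g u v t.
  have defectE x : phase_defect x = f x - g x by [].
  by rewrite /polar3 !defectE; ring.
have trace2_sum := big_morph _ (trace2D card_F w_eq) (trace2_0 card_F w_eq).
apply/eqP; rewrite subr_eq0 /f /g !polar3_sum; apply/eqP.
transitivity (trace2 w (\sum_i (u *m G) 0 i * (v *m G) 0 i * (t *m G) 0 i)).
  rewrite trace2_sum; apply: eq_bigr => i _.
  by rewrite -polar3_cfun // /polar3 !mulmxDl !mxE.
rewrite triorthogonal_sum trace2_sum; apply: eq_bigr => a _.
by rewrite -polar3_cfun // /polar3 !mxE.
Qed.

Lemma triorthogonal_CS : exists U : 'M[C]_#|{: 'rV[F]_m}|,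
  [/\ is_diag_mx U, is_clifford w U &
      D_ C w G =
        U *m tensor_op (fun a => if (a < k)%N then CS C w else 1%:M)].
Proof.
exists (diag_op (fun u => ipow (phase_defect u))); split.
- exact: diag_op_is_diag.
- by apply: quadratic_phase_clifford => // u v t; exact: phase_defect_quadratic.
(* The identity on the qudits a >= k is the diagonal phase with exponent 0, so the whole tensor
   product is diagonal and exponents add. *)
rewrite (@tensor_diag_op _ _ _ _
  (fun a g => ipow (if (a < k)%N then (cfun w g)%:R else 0))); last first.
  move=> a; apply: eq_entry => g h; rewrite entry_diag_op.
  case: ifP => _; last by rewrite entry1.
  by rewrite entry_diag_op ipow_nat.
apply: eq_entry => u v; rewrite entry_diag_mul !entry_diag_op.
rewrite mulrnAr -ipow_sum -big_mkcond -ipowD /phase_defect subrK -ipow_nat natr_sum.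
by congr (ipow _ *+ _); apply: eq_bigr => i _; rewrite mxE.
Qed.

End Triorthogonal.

(** * The points and rows in bit pairs, where sums over the plane can be computed *)

Section PlaneOverF4.
Variables (F : finFieldType) (w : F).
Hypotheses (card_F : #|F| = 4%N) (w_eq : w ^+ 2 = w + 1).

Local Notation bits2 := (bool * bool)%type.
Local Notation zero2 := (false, false).
Local Notation one2 := (true, true).
Local Notation omega2 := (true, false).

Definition all_bits2 : seq bits2 := [:: zero2; one2; omega2; (false, true)].

Definition plane_bits : seq (bits2 * bits2 * bits2) :=
  [seq (one2, y, z) | y <- all_bits2, z <- all_bits2] ++
  [seq (zero2, one2, z) | z <- all_bits2] ++ [:: (zero2, zero2, one2)].

Definition unbits3 (p : bits2 * bits2 * bits2) : F * F * F :=
  (unbits w p.1.1, unbits w p.1.2, unbits w p.2).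

Definition cube2 a := mulb2 a (mulb2 a a).

Definition row_bits (p : bits2 * bits2 * bits2) : seq bits2 :=
  let: (X, Y, Z) := p in
  [:: mulb2 X (addb2 (cube2 Z) (mulb2 omega2 (cube2 Y)));
      mulb2 Y (addb2 (cube2 X) (mulb2 omega2 (cube2 Z)));
      mulb2 Z (addb2 (cube2 Y) (mulb2 omega2 (cube2 X)));
      mulb2 (mulb2 X Y) (mulb2 Z Z);
      X; Y; Z].

Definition sumb2 (s : seq bits2) := foldr addb2 zero2 s.

Lemma unbits0 : unbits w zero2 = 0.
Proof. by rewrite unbitsE. Qed.

Lemma unbits1 : unbits w one2 = 1.
Proof. by rewrite unbitsE. Qed.

Lemma unbits_omega : unbits w omega2 = w.
Proof. by rewrite unbitsE. Qed.

Lemma unbits3_inj : injective unbits3.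
Proof.
by move=> [[x y] z] [[x' y'] z'] [/unbits_inj-> // /unbits_inj-> // /unbits_inj->].
Qed.

Lemma unbits_sum s : unbits w (sumb2 s) = \sum_(b <- s) unbits w b.
Proof.
elim: s => [|b s IHs]; first by rewrite big_nil unbits0.
by rewrite big_cons /= unbitsD // IHs.
Qed.

Lemma row_evals_bits p : row_evals w (unbits3 p) = map (unbits w) (row_bits p).
Proof.
case: p => [[X Y] Z]; rewrite /unbits3 /= !(unbitsM, unbitsD) //.
by rewrite unbits_omega !exprS expr0 !mulr1.
Qed.

Lemma enum_bits : perm_eq (enum F) (map (unbits w) all_bits2).
Proof.
apply: uniq_perm; rewrite ?enum_uniq ?map_inj_uniq //; first exact: unbits_inj.
move=> g; rewrite mem_enum -(bitsK card_F w_eq g) mem_map; last exact: unbits_inj.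
by case: (bits w g) => [[] []].
Qed.

(** The order of [enum F] is unspecified, so the lists agree only up to permutation; sums over all
    columns do not see the order. *)
Lemma plane_points_bits : perm_eq (plane_points F) (map unbits3 plane_bits).
Proof.
have -> : map unbits3 plane_bits =
    [seq (unbits w one2, y, z) | y <- map (unbits w) all_bits2,
                                 z <- map (unbits w) all_bits2] ++
    [seq (unbits w zero2, unbits w one2, z) | z <- map (unbits w) all_bits2] ++
    [:: (unbits w zero2, unbits w zero2, unbits w one2)] by [].
rewrite unbits0 unbits1; apply: perm_cat.
  exact: perm_allpairs enum_bits enum_bits.
by apply: perm_cat => //; exact: perm_map enum_bits.
Qed.

Lemma size_plane_points : size (plane_points F) = 21%N.
Proof. by rewrite (perm_size plane_points_bits). Qed.

Lemma plane_points_uniq : uniq (plane_points F).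
Proof.
rewrite (perm_uniq plane_points_bits) map_inj_uniq //; exact: unbits3_inj.
Qed.

Local Notation point := (nth (0, 0, 0) (plane_points F)).

Lemma big_plane (R : Type) (idx : R) (op : Monoid.com_law idx) (f : F * F * F -> R) :
  \big[op/idx]_(i < 21) f (point i) = \big[op/idx]_(b <- plane_bits) f (unbits3 b).
Proof.
rewrite -(big_map unbits3 predT f) -(perm_big _ plane_points_bits) /=.
by rewrite (big_nth (0, 0, 0)) size_plane_points big_mkord.
Qed.

(** Turns a column sum in the abstract field into a Boolean term open to evaluation. *)
Lemma sum_plane (f : F * F * F -> F) (fb : bits2 * bits2 * bits2 -> bits2) :
  (forall b, f (unbits3 b) = unbits w (fb b)) ->
  \sum_(i < 21) f (point i) = unbits w (sumb2 (map fb plane_bits)).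
Proof.
move=> f_fb; rewrite big_plane unbits_sum big_map.
by apply: eq_bigr => b _.
Qed.

Lemma point_index p : p \in plane_points F -> exists i : 'I_21, point i = p.
Proof.
move=> pP; have := pP; rewrite -index_mem size_plane_points => lt_p.
by exists (Ordinal lt_p); rewrite /= nth_index.
Qed.

Lemma mem_plane_points (b : bits2 * bits2 * bits2) :
  (unbits3 b \in plane_points F) = (b \in plane_bits).
Proof. by rewrite (perm_mem plane_points_bits) mem_map //; exact: unbits3_inj. Qed.

Lemma row_evals_nth a b :
  nth 0 (row_evals w (unbits3 b)) a = unbits w (nth zero2 (row_bits b) a).
Proof.
rewrite row_evals_bits -unbits0.
have [lt_a|le_a] := ltnP a (size (row_bits b)); first by rewrite (nth_map zero2).
by rewrite !nth_default ?size_map // unbits0.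
Qed.

(** * Trilinear sums and rank of the matrix *)

Lemma plane_triorthogonal (a b c : 'I_7) :
  \sum_i plane_matrix w a i * plane_matrix w b i * plane_matrix w c i =
  if [&& a == b, b == c & (a < 4)%N] then 1 else 0.
Proof.
pose r p (d : nat) := nth zero2 (row_bits p) d.
pose s d e f := sumb2 (map (fun p => mulb2 (mulb2 (r p d) (r p e)) (r p f)) plane_bits).
transitivity (unbits w (s a b c)).
  under eq_bigr do rewrite !mxE.
  apply: (sum_plane (f := fun p => nth 0 (row_evals w p) a *
    nth 0 (row_evals w p) b * nth 0 (row_evals w p) c)) => p.
  by rewrite !row_evals_nth !unbitsM.
(* All 343 triples of rows are evaluated on bit pairs. *)
have sE : all (fun d => all (fun e => all (fun f =>
    s d e f == if [&& d == e, e == f & (d < 4)%N] then one2 else zero2)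
  (iota 0 7)) (iota 0 7)) (iota 0 7) by vm_compute.
have in7 (d : 'I_7) : (d : nat) \in iota 0 7 by rewrite mem_iota ltn_ord.
have /allP/(_ _ (in7 b))/allP/(_ _ (in7 c))/eqP-> := allP sE _ (in7 a).
by rewrite -!val_eqE; case: ifP; rewrite ?unbits1 ?unbits0.
Qed.

Lemma plane_matrix_full_rank : \rank (plane_matrix w) = 7%N.
Proof.
apply/eqP; change (row_free (plane_matrix w)); apply: inj_row_free => u uG.
have comb b : b \in plane_bits ->
    \sum_a u 0 a * unbits w (nth zero2 (row_bits b) a) = 0.
  rewrite -mem_plane_points => /point_index[i pt_i].
  have uGi : (u *m plane_matrix w) 0 i = 0 by rewrite uG mxE.
  rewrite -[RHS]uGi mxE; apply: eq_bigr => a _.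
  by rewrite mxE pt_i row_evals_nth.
(* At a coordinate point the four logical polynomials vanish and just one of X, Y, Z is nonzero,
   which isolates one stabilizer coefficient. *)
have u4 := comb (one2, zero2, zero2) isT.
have u5 := comb (zero2, one2, zero2) isT.
have u6 := comb (zero2, zero2, one2) isT.
rewrite !big_ord_recl big_ord0 /= in u4 u5 u6.
rewrite ?unbits0 ?unbits1 ?mulr0 ?mulr1 ?add0r ?addr0 in u4 u5 u6.
(* Pairing u G with the entrywise square of logical row c gives u_c, by the trilinear sums with
   indices (a, c, c). *)
have low (c : 'I_7) : (c < 4)%N -> u 0 c = 0.
  move=> lt_c4; transitivity (\sum_i (u *m plane_matrix w) 0 i *
      plane_matrix w c i * plane_matrix w c i); last first.
    by apply: big1 => i _; rewrite uG mxE !mul0r.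
  under eq_bigr => i _ do rewrite mxE !mulr_suml.
  rewrite exchange_big /=.
  transitivity (\sum_a u 0 a * (if a == c then 1 else 0)).
    rewrite (bigD1 c) //= eqxx mulr1 big1 ?addr0 // => a /negPf ->.
    by rewrite mulr0.
  apply: eq_bigr => a _.
  have -> : (if a == c then 1 else 0) = \sum_i plane_matrix w a i *
      plane_matrix w c i * plane_matrix w c i.
    by rewrite plane_triorthogonal eqxx; case: eqP => [->|//]; rewrite lt_c4.
  by rewrite mulr_sumr; apply: eq_bigr => i _; rewrite !mulrA.
apply/rowP => a; rewrite mxE; case: (ltnP a 4) => [/low //|].
case: a => [[|[|[|[|[|[|[|]]]]]]] ?] // _.
- by rewrite -[RHS]u4; congr (u 0 _); apply/val_inj.
- by rewrite -[RHS]u5; congr (u 0 _); apply/val_inj.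
- by rewrite -[RHS]u6; congr (u 0 _); apply/val_inj.
Qed.

(** * The Z-distance: pairwise independent points, and a word of weight 3 *)

Lemma plane_points_normalized p : p \in plane_points F ->
  [\/ p.1.1 = 1, p.1.1 = 0 /\ p.1.2 = 1 | p = (0, 0, 1)].
Proof.
rewrite !mem_cat => /or3P[/allpairsP[[y z] [_ _ ->]]|/mapP[z _ ->]|].
- by constructor 1.
- by constructor 2.
by rewrite inE => /eqP ->; constructor 3.
Qed.

Lemma plane_point_neq0 p x : p \in plane_points F ->
  x * p.1.1 = 0 -> x * p.1.2 = 0 -> x * p.2 = 0 -> x = 0.
Proof.
by case/plane_points_normalized => [->|[_ ->]|->] /=; rewrite mulr1.
Qed.

(** The first nonzero coordinate of each point is 1. If these positions differ, one equation forces
    x = 0 or y = 0; if they agree, y = -x and the other coordinates coincide. *)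
Lemma plane_points_independent p q x y :
  p \in plane_points F -> q \in plane_points F ->
  x != 0 -> y != 0 ->
  x * p.1.1 + y * q.1.1 = 0 -> x * p.1.2 + y * q.1.2 = 0 ->
  x * p.2 + y * q.2 = 0 -> p = q.
Proof.
move=> pP qP /negPf x0 /negPf y0.
have cancel_xy r s : y = - x -> x * r + y * s = 0 -> r = s.
  move=> -> /eqP; rewrite mulNr -mulrBr mulf_eq0 x0 subr_eq0 /=.
  by move/eqP.
move: (plane_points_normalized pP) (plane_points_normalized qP).
case: p q {pP qP} => [[p1 p2] p3] [[q1 q2] q3] /=.
case=> [->|[-> ->]|[-> -> ->]]; case=> [->|[-> ->]|[-> -> ->]];
  rewrite ?(mulr1, mulr0, addr0, add0r) => e1 e2 e3 //;
  try (by move/eqP: e1; rewrite ?x0 ?y0); try (by move/eqP: e2; rewrite ?x0 ?y0).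
- have yE : y = - x by apply/eqP; rewrite -addr_eq0 addrC e1.
  by rewrite (cancel_xy _ _ yE e2) (cancel_xy _ _ yE e3).
- have yE : y = - x by apply/eqP; rewrite -addr_eq0 addrC e2.
  by rewrite (cancel_xy _ _ yE e3).
Qed.

Lemma weight_ge3 (x : 'rV[F]_21) :
  (forall a : 'I_7, (4 <= a)%N -> \sum_i x 0 i * plane_matrix w a i = 0) ->
  x != 0 -> (3 <= weight x)%N.
Proof.
move=> stab x_neq0; rewrite leqNgt; apply/negP => small.
pose S := [set i | x 0 i != 0].
have stabS (a : 'I_7) : (4 <= a)%N ->
    \sum_(i in S) x 0 i * nth 0 (row_evals w (point i)) a = 0.
  move=> /stab ea; rewrite -[RHS]ea big_mkcond; apply: eq_bigr => i _.
  by rewrite inE mxE; case: eqP => // ->; rewrite mul0r.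
have pt_in (i : 'I_21) : point i \in plane_points F.
  by rewrite mem_nth // size_plane_points.
have {stabS} [S1 S2 S3] : [/\ \sum_(i in S) x 0 i * (point i).1.1 = 0,
    \sum_(i in S) x 0 i * (point i).1.2 = 0 &
    \sum_(i in S) x 0 i * (point i).2 = 0].
  (* Rows 4, 5 and 6 are the evaluations of X, Y and Z. *)
  split; [rewrite -[RHS](stabS (inord 4)) | rewrite -[RHS](stabS (inord 5))
         | rewrite -[RHS](stabS (inord 6))]; rewrite ?inordK //;
  by apply: eq_bigr => i _; case: (point i) => [[? ?] ?].
have inS i : i \in S -> x 0 i != 0 by rewrite inE.
have [S0|[[i Si]|[i [j [ij Sij]]]]] :
    S = set0 \/ ((exists i, S = [set i]) \/ exists i j, i != j /\ S = [set i; j]).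
- move: small; rewrite /weight -/S; case E: #|S| => [|[|[|]]] // _.
  + by left; apply: cards0_eq.
  + by right; left; apply/cards1P; rewrite E.
  + by right; right; apply/cards2P; rewrite E.
- case/eqP: x_neq0; apply/rowP => i; rewrite mxE; apply/eqP.
  by have := in_set0 i; rewrite -S0 inE => /negbFE.
- have /eqP[] : x 0 i != 0 by rewrite inS // Si set11.
  rewrite Si !big_set1 in S1 S2 S3.
  exact: (plane_point_neq0 (pt_in i) S1 S2 S3).
have xi : x 0 i != 0 by rewrite inS // Sij set21.
have xj : x 0 j != 0 by rewrite inS // Sij set22.
rewrite Sij !big_setU1 ?inE //= !big_set1 in S1 S2 S3.
have /eqP := plane_points_independent (pt_in i) (pt_in j) xi xj S1 S2 S3.
by rewrite nth_uniq ?size_plane_points ?plane_points_uniq //; apply/negP.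
Qed.

(* In characteristic 2 these three collinear points sum to 0, and
   X (Z^3 + w Y^3) is nonzero only at the third one. *)
Definition line_word_support : seq (bits2 * bits2 * bits2) :=
  [:: (one2, zero2, zero2); (zero2, one2, zero2); (one2, one2, zero2)].

Definition line_word : 'rV[F]_21 :=
  \row_i (point i \in map unbits3 line_word_support)%:R.

Lemma line_word_weight : weight line_word = 3%N.
Proof.
have natb_neq0 (b : bool) : (b%:R != 0 :> F) = b.
  by case: b; rewrite ?oner_eq0 ?eqxx.
rewrite /weight -sum1_card big_mkcond.
under eq_bigr do rewrite inE mxE natb_neq0.
rewrite (big_plane _ (fun p => if p \in map unbits3 line_word_support then 1%N else 0%N)).
rewrite -big_mkcond sum1_count (eq_count (a2 := mem line_word_support)) // => b.
by rewrite mem_map //; exact: unbits3_inj.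
Qed.

(** At the point (1, 1, 0) the first two polynomials take the values w and 1; the default 0 of [nth]
    covers all other rows, in particular the stabilizers. *)
Lemma line_word_product (a : 'I_7) :
  \sum_i line_word 0 i * plane_matrix w a i = nth 0 [:: w; 1] a.
Proof.
transitivity (unbits w (sumb2 (map (fun b =>
  mulb2 (if b \in line_word_support then one2 else zero2)
    (nth zero2 (row_bits b) a)) plane_bits))).
  under eq_bigr do rewrite !mxE.
  apply: (sum_plane (f := fun p =>
    (p \in map unbits3 line_word_support)%:R * nth 0 (row_evals w p) a)) => b.
  rewrite row_evals_nth unbitsM // mem_map; last exact: unbits3_inj.
  by case: ifP; rewrite ?unbits0 ?unbits1.
rewrite (_ : sumb2 _ = nth zero2 [:: omega2; one2] a).
  by case: a => [[|[|a]] ?] /=; rewrite ?nth_nil ?unbits_omega ?unbits1 ?unbits0.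
by case: a => [[|[|[|[|[|[|[|]]]]]]] ?] //; vm_compute.
Qed.

Lemma plane_Z_distance : has_Z_distance (plane_matrix w) 4 3.
Proof.
split=> [|x [stab [a [_ xa]]]].
  exists line_word; split; last exact: line_word_weight.
  split=> [a le4a|]; first by rewrite line_word_product nth_default // (leq_trans _ le4a).
  (* Logical row 0 pairs to w, and w = 0 would turn w^2 = w + 1 into 0 = 1. *)
  exists 0; split=> //; rewrite line_word_product /= => w0.
  by move/eqP: w_eq; rewrite w0 expr0n add0r eq_sym oner_eq0.
(* The zero vector is orthogonal to every logical row, so it is excluded. *)
apply: weight_ge3 => //; apply: contra_not_neq xa => ->.
by apply: big1 => i _; rewrite mxE mul0r.
Qed.

End PlaneOverF4.

Theorem mainTheorem14 (R : realType) (F : finFieldType) (w : F)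
    (card_F : #|F| = 4%N) (w_eq : w ^+ 2 = w + 1) :
  let G : 'M[F]_(7, 21) := plane_matrix w in
  [/\ \rank G = 7%N,
      forall a b c : 'I_7,
        \sum_i G a i * G b i * G c i
          = if [&& a == b, b == c & (a < 4)%N] then 1 else 0,
      exists U : 'M[R[i]]_#|{: 'rV[F]_7}|,
        [/\ is_diag_mx U, is_clifford w U &
            D_ R[i] w G =
              U *m tensor_op (fun a : 'I_7 =>
                     if (a < 4)%N then CS R[i] w else 1%:M)]
    & has_Z_distance G 4 3].
Proof.
move=> G; split.
- exact: plane_matrix_full_rank.
- exact: plane_triorthogonal.
- exact: (triorthogonal_CS _ card_F w_eq (plane_triorthogonal card_F w_eq)).
- exact: plane_Z_distance.
Qed.
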